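(* Let $G$ be a graph. A set $S \subseteq V(G)$ is an ERR:LD set for $G$ if and only if all of the following hold: (i) for every $v \in V(G)$, $|N[v] \cap S| \ge 3$; (ii) for all $v,u \in S$ with $u \neq v$, $|((N(v) \cap S) \triangle (N(u) \cap S)) - \{v,u\}| \ge 1$; (iii) for every $v \in V(G)-S$ and every $u \in S$, $|((N(v) \cap S) \triangle (N(u) \cap S)) - \{u\}| \ge 2$; (iv) for all $v,u \in V(G)-S$ with $u \neq v$, $|(N(v) \cap S) \triangle (N(u) \cap S)| \ge 3$.
   Context: Graphs are simple and undirected. $N(v)$ is the open neighborhood of $v$, $N[v]=N(v)\cup\{v\}$ the closed neighborhood, and $\triangle$ is symmetric difference. ERR:LD sets (error-correcting locating-dominating sets): $S \subseteq V(G)$ is a set of detectors. At most one intruder is present, located at some vertex of $G$. A correctly working detector $v\in S$ transmits $2$ if the intruder is at $v$, $1$ if the intruder is in $N(v)$, and $0$ otherwise (including when there is no intruder). At most one detector may transmit an incorrect value (any wrong value in $\{0,1,2\}$). $S$ is an ERR:LD set if, from the transmitted values, one can always determine whether an intruder is present and, if so, its exact location. Formally: for each scenario $x \in V(G)\cup\{\text{no intruder}\}$ let $\sigma_x : S \to \{0,1,2\}$ be the corresponding correct transmission; $S$ is an ERR:LD set if for any two distinct scenarios $x,y$ there is no function $f: S\to\{0,1,2\}$ which differs from $\sigma_x$ in at most one detector and also differs from $\sigma_y$ in at most one detector. *)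

(* Defs.v *)
From mathcomp Require Import all_boot.
From mathcomp Require Import boolp classical_sets functions cardinality.

Set Implicit Arguments.
Unset Strict Implicit.
Unset Printing Implicit Defensive.

Local Open Scope classical_set_scope.
Local Open Scope card_scope.

(* The vertex type is arbitrary, so infinite graphs are included. Cardinality
   bounds on possibly infinite vertex sets are therefore written with [#<=]:
   |A| >= k is [`I_k #<= A] and |A| <= k is [A #<= `I_k]. *)
Record sgraph := SGraph {
  vertex :> Type;
  adj : vertex -> vertex -> Prop;
  adj_sym : forall u v, adj u v -> adj v u;
  adj_irrefl : forall v, ~ adj v v }.

Definition open_nbh (G : sgraph) (v : G) : set G := [set u | adj v u].

Definition closed_nbh (G : sgraph) (v : G) : set G := open_nbh v `|` [set v].

(* A scenario is [Some v] (intruder at v) or [None] (no intruder). The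
   detectors form the subtype [set_type S], and [val d] is the vertex of d. *)
Definition signal (G : sgraph) (S : set G) (x : option G) (d : set_type S) :
    'I_3 :=
  match x with
  | None => inord 0
  | Some v =>
    if `[< v = val d >] then inord 2
    else if `[< open_nbh (val d) v >] then inord 1
    else inord 0
  end.

Definition at_most_one_error (G : sgraph) (S : set G)
    (f s : set_type S -> 'I_3) : Prop :=
  [set d | f d <> s d] #<= `I_1.

Definition err_ld (G : sgraph) (S : set G) : Prop :=
  forall x y : option G, x <> y ->
    ~ exists f : set_type S -> 'I_3,
        at_most_one_error f (signal x) /\ at_most_one_error f (signal y).

(* Main.v *)
(** A value vector within one error of two correct transmissions exists iff the
    two transmissions differ at no more than two detectors. So [S] is an ERR:LD
    set iff any two scenarios disagree at three or more detectors. An intruder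
    at [v] and no intruder disagree on [N[v] /\ S]; intruders at [v <> u]
    disagree on the part of [S] in [{v, u}] or in the symmetric difference of
    [N(v)] and [N(u)]. Removing from the latter set those of [v], [u] that are
    detectors lowers the bound 3 accordingly. *)
Require Import Defs.
From mathcomp Require Import all_boot.
From mathcomp Require Import boolp classical_sets functions cardinality.

Local Open Scope classical_set_scope.
Local Open Scope card_scope.

Lemma card_ge_II0 {T : Type} (A : set T) : `I_0 #<= A.
Proof. by rewrite II0 card_ge0. Qed.

(** Peeling off one point at a time turns a lower bound into an explicit list of distinct elements,
    with no finiteness assumption on [A]. *)
Lemma card_geSP {T : Type} (A : set T) n :
  `I_n.+1 #<= A <-> exists2 x, A x & `I_n #<= A `\ x.
Proof.
split=> [/card_subP[C /eq_cardSP[x Cx Cn] CA]|[x Ax /card_subP[C Cn CA]]].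
  exists x; first exact: CA.
  by apply/card_subP; exists (C `\ x) => //; apply: setSD.
apply/card_subP; exists (x |` C); last first.
  by move=> y [->//|/CA[]].
apply/eq_cardSP; exists x; first by left.
suff -> : (x |` C) `\ x = C by [].
by apply/seteqP; split=> [y [[]]//|y Cy]; split; [right | have [] := CA _ Cy].
Qed.

(** The point peeled off can be prescribed: if [card_geSP] offers some [y] other than [x], induction
    removes [x] from [A] without [y], and the two removals commute. *)
Lemma card_ge_setD1 {T : Type} (A : set T) x n :
  A x -> `I_n.+1 #<= A <-> `I_n #<= A `\ x.
Proof.
move=> Ax; split=> [|An]; last by apply/card_geSP; exists x.
elim: n A Ax => [|n IHn] A Ax; first by move=> _; apply: card_ge_II0.
move=> /card_geSP[y Ay]; have [->//|yx] := pselect (y = x).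
have Dx : (A `\ y) x by split=> // xy; apply: yx.
move=> /(IHn _ Dx); rewrite setDDl setUC -setDDl => An.
by apply/card_geSP; exists y.
Qed.

Lemma card_le1P {T : Type} (A : set T) : A #<= `I_1 <-> is_subset1 A.
Proof.
split=> [A1 x y Ax Ay|A1].
  apply: contrapT => xy.
  have : `I_2 #<= A.
    apply/(card_ge_setD1 _ _ _ Ax)/card_geSP; exists y; last exact: card_ge_II0.
    by split=> // yx; apply: xy.
  by move=> /card_le_trans/(_ A1); rewrite card_le_II.
have [->|/set0P[x Ax]] := eqVneq A set0; first by rewrite card_ge0.
have -> : A = [set x] by apply/seteqP; split=> [y Ay|y ->] //=; exact: A1.
by have /card_eqPle[] := @card_set1 _ x.
Qed.

(** In terms of Hamming distance, the radius-one balls around [s] and [t] are disjoint exactly when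
    their centers are at distance at least 3. *)
Lemma one_error_balls_disjointP {T U : Type} (s t : T -> U) :
  (~ exists f : T -> U,
      [set d | f d <> s d] #<= `I_1 /\ [set d | f d <> t d] #<= `I_1) <->
  `I_3 #<= [set d | s d <> t d].
Proof.
split=> [nf|/card_geSP[a sta /card_geSP[b [stb ab]] /card_geSP[c [[stc ac] bc] _]]].
  have far f : is_subset1 [set d | f d <> t d] ->
      exists a b, [/\ f a <> s a, f b <> s b & a <> b].
    move=> ft; apply: contrapT => nab; apply: nf; exists f.
    split; apply/card_le1P => // a b fa fb; apply: contrapT => ab.
    by apply: nab; exists a, b.
  (* Taking [t] itself as the received vector yields a first disagreement [a]. *)
  have [|a [_ [sta _ _]]] := far t; first by move=> d e /(_ erefl).
  (* Switching [t] to [s] at [a] costs one error against [t], so two errors against [s] remain. They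
     avoid [a], hence are two further disagreements of [s] and [t]. *)
  pose f d := if `[< d = a >] then s d else t d.
  have fE d : d <> a -> f d = t d by move=> da; rewrite /f asboolF.
  have fa : f a = s a by rewrite /f asboolT.
  have [|b [c [fb fc bc]]] := far f.
    have sub d : f d <> t d -> d = a by move=> ft; apply: contrapT => /fE.
    by move=> d e /sub-> /sub->.
  have ba : b <> a by move=> ba; apply: fb; rewrite ba.
  have ca : c <> a by move=> ca; apply: fc; rewrite ca.
  rewrite fE // in fb; rewrite fE // in fc.
  apply/card_geSP; exists a; first by move=> /esym.
  apply/card_geSP; exists b; first by split=> // /esym.
  apply/card_geSP; exists c; last exact: card_ge_II0.
  by split; [split=> // /esym | move=> /esym].
move=> [f [/card_le1P fs /card_le1P ft]].
have err d : s d <> t d -> f d <> s d \/ f d <> t d.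
  by move=> st; have [->|] := pselect (f d = s d); [right | left].
(* Pigeonhole: among the three points, two are errors against the same center. *)
have [fa|fa] := err a sta; have [fb|fb] := err b stb;
  have [fc|fc] := err c stc.
- by apply: ab; apply: fs.
- by apply: ab; apply: fs.
- by apply: ac; apply: fs.
- by apply: bc; apply: ft.
- by apply: bc; apply: fs.
- by apply: ac; apply: ft.
- by apply: ab; apply: ft.
- by apply: ab; apply: ft.
Qed.

(** Taking the image under [val] moves the detectors from the subtype into [G], where they can be
    compared with neighborhoods; injectivity of [val] preserves cardinality. *)
Definition disagreement {G : sgraph} (S : set G) (x y : option G) : set G :=
  val @` [set d : set_type S | signal x d <> signal y d].

Lemma err_ldP {G : sgraph} (S : set G) :
  err_ld S <-> forall x y : option G, x <> y -> `I_3 #<= disagreement S x y.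
Proof.
have disE (x y : option G) : (`I_3 #<= disagreement S x y) =
    (`I_3 #<= [set d : set_type S | signal x d <> signal y d]).
  by apply/card_le_eqr/inj_card_eq; apply: in2W; apply: val_inj.
by split=> ld x y xy; [rewrite disE | have := ld x y xy; rewrite disE];
  [have /one_error_balls_disjointP := ld x y xy | move/one_error_balls_disjointP].
Qed.

Lemma inord_eq3 (i j : nat) : i < 3 -> j < 3 ->
  (inord i = inord j :> 'I_3) <-> i = j.
Proof.
move=> i3 j3; split=> [/(congr1 val)|->//].
by rewrite /= !inordK.
Qed.

Lemma adjC {G : sgraph} (u v : G) : adj u v = adj v u.
Proof. by apply/propext; split; apply: adj_sym. Qed.

Lemma signal_NoneE {G : sgraph} (S : set G) (v : G) (d : set_type S) :
  signal None d <> signal (Some v) d <-> closed_nbh v (val d).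
Proof.
rewrite /signal /closed_nbh /open_nbh /=.
have [->|vd] := pselect (v = val d).
  by rewrite asboolT // inord_eq3 //; split=> // _; right.
rewrite asboolF // adjC.
have [a|na] := pselect (adj v (val d)).
  by rewrite asboolT // inord_eq3 //; split=> // _; left.
by rewrite asboolF //; split=> // -[//|/esym].
Qed.

(** A detector at [v] or [u] sends 2 in exactly one of the two scenarios. Any other detector sends
    the indicator of adjacency to the intruder. *)
Lemma signal_SomeE {G : sgraph} (S : set G) (v u : G) (d : set_type S) :
  v <> u ->
  signal (Some v) d <> signal (Some u) d <->
  ([set v; u] `|` (open_nbh v `+` open_nbh u)) (val d).
Proof.
move=> vu; rewrite /signal /open_nbh /=.
have [vd|vd] := pselect (v = val d).
  rewrite asboolT // asboolF; last by rewrite -vd => /esym.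
  split=> [_|_]; first by left; left.
  by case: ifP => _; rewrite inord_eq3.
rewrite asboolF // (adjC _ v) (adjC _ u).
have [ud|ud] := pselect (u = val d).
  rewrite (asboolT ud); split=> [_|_]; first by left; right.
  by case: ifP => _; rewrite inord_eq3.
rewrite (asboolF ud).
have [av|av] := pselect (adj v (val d)); [rewrite asboolT | rewrite asboolF] => //;
have [au|au] := pselect (adj u (val d)); [rewrite asboolT | rewrite asboolF
   | rewrite asboolT | rewrite asboolF] => //; rewrite ?inord_eq3 //;
  split=> //.
- by case=> [[/esym|/esym]|[][]].
- by move=> _; right; left.
- by move=> _; right; right.
- by case=> [[/esym|/esym]|[][]].
Qed.

Lemma image_val_setI {T : Type} (S A : set T) (P : set (set_type S)) :
  (forall d, P d <-> A (val d)) -> val @` P = A `&` S.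
Proof.
move=> PA; apply/seteqP; split=> [x [d /PA Ad <-]|x [Ax Sx]].
  by split=> //; apply: set_valP.
by exists (SigSub (mem_set Sx)) => //; apply/PA.
Qed.

Lemma disagreement_None {G : sgraph} (S : set G) (v : G) :
  disagreement S None (Some v) = closed_nbh v `&` S.
Proof. by apply: image_val_setI => d; apply: signal_NoneE. Qed.

Lemma disagreement_Some {G : sgraph} (S : set G) (v u : G) : v <> u ->
  disagreement S (Some v) (Some u) =
  ([set v; u] `&` S) `|` ((open_nbh v `&` S) `+` (open_nbh u `&` S)).
Proof.
move=> vu; rewrite -setIYl -setIUl.
by apply: image_val_setI => d; apply: signal_SomeE.
Qed.

Lemma disagreementC {G : sgraph} (S : set G) (x y : option G) :
  disagreement S x y = disagreement S y x.
Proof. by congr image; apply/seteqP; split=> d xy /esym. Qed.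

Lemma disagreement_in_in {G : sgraph} (S : set G) (v u : G) :
  S v -> S u -> u <> v ->
  `I_3 #<= disagreement S (Some v) (Some u) <->
  `I_1 #<= ((open_nbh v `&` S) `+` (open_nbh u `&` S)) `\` [set v; u].
Proof.
move=> Sv Su uv; rewrite disagreement_Some; last by move=> /esym.
(* Both [v] and [u] are disagreeing detectors, so removing them lowers the bound from 3 to 1. *)
rewrite (card_ge_setD1 _ v); last by left; split=> //; left.
rewrite (card_ge_setD1 _ u); last by split=> //; left; split=> //; right.
rewrite setDDl setDUl.
have -> : ([set v; u] `&` S) `\` [set v; u] = set0 by rewrite setD_eq0 => x [].
by rewrite set0U.
Qed.

Lemma disagreement_out_in {G : sgraph} (S : set G) (v u : G) :
  ~ S v -> S u ->
  `I_3 #<= disagreement S (Some v) (Some u) <->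
  `I_2 #<= ((open_nbh v `&` S) `+` (open_nbh u `&` S)) `\` [set u].
Proof.
move=> Sv Su; rewrite disagreement_Some; last by move=> vu; rewrite vu in Sv.
rewrite (card_ge_setD1 _ u); last by left; split=> //; right.
have -> : [set v; u] `&` S = [set u].
  by apply/seteqP; split=> [x [[->//|->//]]|x ->]; split=> //; right.
by rewrite setDUl setDv set0U.
Qed.

Lemma disagreement_out_out {G : sgraph} (S : set G) (v u : G) :
  ~ S v -> ~ S u -> u <> v ->
  disagreement S (Some v) (Some u) =
  (open_nbh v `&` S) `+` (open_nbh u `&` S).
Proof.
move=> Sv Su uv; rewrite disagreement_Some; last by move=> /esym.
have -> : [set v; u] `&` S = set0 by apply/seteqP; split=> [x [[]->]|].
by rewrite set0U.
Qed.

Theorem theorem2p4 (G : sgraph) (S : set G) :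
  err_ld S <->
  [/\ forall v : G, `I_3 #<= closed_nbh v `&` S,
      forall v u : G, S v -> S u -> u <> v ->
        `I_1 #<= ((open_nbh v `&` S) `+` (open_nbh u `&` S)) `\` [set v; u],
      forall v u : G, ~ S v -> S u ->
        `I_2 #<= ((open_nbh v `&` S) `+` (open_nbh u `&` S)) `\` [set u]
    & forall v u : G, ~ S v -> ~ S u -> u <> v ->
        `I_3 #<= (open_nbh v `&` S) `+` (open_nbh u `&` S) ].
Proof.
rewrite err_ldP; split=> [ld|[i ii iii iv]].
  split=> [v|v u Sv Su uv|v u Sv Su|v u Sv Su uv].
  - by rewrite -disagreement_None; apply: ld.
  - by apply/disagreement_in_in => //; apply: ld => -[/esym].
  - by apply/disagreement_out_in => //; apply: ld => -[vu]; rewrite vu in Sv.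
  - by rewrite -disagreement_out_out //; apply: ld => -[/esym].
move=> [v|] [u|] // xy; last 2 first.
- by rewrite disagreementC disagreement_None.
- by rewrite disagreement_None.
have uv : u <> v by move=> uv; apply: xy; rewrite uv.
have [Sv|Sv] := pselect (S v); have [Su|Su] := pselect (S u).
- by apply/disagreement_in_in => //; apply: ii.
(* Condition (iii) lists the non-detector first, so the scenarios are swapped. *)
- by rewrite disagreementC; apply/disagreement_out_in => //; apply: iii.
- by apply/disagreement_out_in => //; apply: iii.
- by rewrite disagreement_out_out //; apply: iv.
Qed.
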